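(* For $0<\alpha\le1$ let $\zeta(s,\alpha)=\frac1{s-1}+\sum_{r\ge0}\gamma_r(\alpha)(s-1)^r$ be the Laurent expansion of the Hurwitz zeta function at $s=1$. Let $q\ge1$ be an integer and, for integers $1\le a\le q$ and $r\ge0$, define $\gamma_r(a,q)$ by $$(-1)^r\gamma_r(a,q)=\lim_{s\to1}\frac{d^r}{ds^r}\Big\{q^{-s}\Big(\zeta\big(s,\tfrac aq\big)-\frac1{s-1}\Big)\Big\},$$ so that $L^{(r)}(1,\chi)=\sum_{a=1}^q\chi(a)\cdot(-1)^r\gamma_r(a,q)$ for every non-principal Dirichlet character $\chi$ modulo $q$. Then $$(-1)^r\gamma_r(a,q)=\frac{r!}{q}\sum_{\ell=0}^r\frac{(-1)^\ell}{\ell!}\log^\ell q\cdot\gamma_{r-\ell}\big(\tfrac aq\big).$$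
   Context: For $0<\alpha\le1$, $\zeta(s,\alpha)$ is the Hurwitz zeta function, $\zeta(s,\alpha)=\sum_{n\ge0}(n+\alpha)^{-s}$ for $\mathrm{Re}\,s>1$, together with its analytic continuation. $L(s,\chi)=\sum_{n\ge1}\chi(n)n^{-s}$ for $\mathrm{Re}\,s>1$, together with its analytic continuation; $L^{(r)}$ is its $r$-th derivative with respect to $s$. $\log^\ell q=(\log q)^\ell$, with $\log^0q=1$. *)

(* Defs.v *)
From HB Require Import structures.
From mathcomp Require Import all_boot all_order all_algebra.
From mathcomp Require Import complex.
From mathcomp Require Import all_classical all_reals all_analysis.
Set Implicit Arguments.
Unset Strict Implicit.
Unset Printing Implicit Defensive.
Import Order.TTheory GRing.Theory Num.Theory.
Import numFieldNormedType.Exports.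
Local Open Scope classical_set_scope.
Local Open Scope complex_scope.
Local Open Scope ring_scope.

(* The complex numbers, packaged as a numClosedFieldType so that the topology
   that MathComp-Analysis puts on numeric fields is inferred on them; with it,
   derive1n is the iterated complex derivative. *)
Definition CC (R : realType) : numClosedFieldType := R[i].

Definition toC {R : realType} (x : R) : CC R := x%:C.

Definition cexp {R : realType} (z : CC R) : CC R :=
  (expR (complex.Re z) * cos (complex.Im z))
    +i* (expR (complex.Re z) * sin (complex.Im z)).

(* x ^ s for real x > 0 *)
Definition cpow {R : realType} (x : R) (s : CC R) : CC R :=
  cexp (s * toC (ln x)).

Definition analytic_at {R : realType} (f : CC R -> CC R) (z0 : CC R) : Prop :=
  exists c : nat -> CC R,
    \forall z \near z0,
      series (fun k : nat => c k * (z - z0) ^+ k) @ \oo --> f z.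

(* Z is s |-> zeta(s, alpha), continued to the complex plane minus {1}. *)
Definition is_hurwitz_zeta {R : realType} (alpha : R) (Z : CC R -> CC R) : Prop :=
  (forall s : CC R, 1 < complex.Re s ->
     series (fun n : nat => cpow (n%:R + alpha) (- s)) @ \oo --> Z s) /\
  (forall s : CC R, s != 1 -> analytic_at Z s).

(* Z s = 1 / (s - 1) + \sum_(r >= 0) g r * (s - 1) ^+ r around s = 1 *)
Definition is_laurent_at1 {R : realType} (Z : CC R -> CC R) (g : nat -> CC R) :
    Prop :=
  \forall s \near (1 : CC R)^',
    series (fun r : nat => g r * (s - 1) ^+ r) @ \oo --> Z s - (s - 1)^-1.

(* Characters modulo q as functions on nat: such a function is determined by
   its values on the residues 1, ..., q. *)
Definition is_dirichlet_character {R : realType} (q : nat) (chi : nat -> CC R) :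
    Prop :=
  [/\ chi 1%N = 1,
      forall m n : nat, chi (m * n)%N = chi m * chi n,
      forall n : nat, chi (n + q)%N = chi n &
      forall n : nat, (chi n == 0) = ~~ coprime n q].

Definition is_principal {R : realType} (q : nat) (chi : nat -> CC R) : Prop :=
  forall n : nat, coprime n q -> chi n = 1.

(* L is s |-> L(s, chi) for a non-principal chi: the continuation is then
   analytic on the whole complex plane, s = 1 included. *)
Definition is_dirichlet_L {R : realType} (chi : nat -> CC R) (L : CC R -> CC R) :
    Prop :=
  (forall s : CC R, 1 < complex.Re s ->
     series (fun n : nat => chi n.+1 * cpow n.+1%:R (- s)) @ \oo --> L s) /\
  (forall s : CC R, analytic_at L s).

(* q ^ (-s) * (zeta(s, a / q) - 1 / (s - 1)); meaningful for s != 1 only *)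
Definition hurwitz_reg {R : realType} (zeta : R -> CC R -> CC R) (a q : nat)
    (s : CC R) : CC R :=
  cpow q%:R (- s) * (zeta (a%:R / q%:R) s - (s - 1)^-1).

Definition gamma_mod {R : realType} (zeta : R -> CC R -> CC R) (r a q : nat) :
    CC R :=
  (-1) ^+ r * lim (derive1n r (hurwitz_reg zeta a q) s @[s --> (1 : CC R)^']).

(* Main.v *)
Require Import Defs.
From HB Require Import structures.
From mathcomp Require Import all_boot all_order all_algebra.
From mathcomp Require Import complex.
From mathcomp Require Import all_classical all_reals all_analysis.
From mathcomp Require Import ring lra.
Set Implicit Arguments.
Unset Strict Implicit.
Unset Printing Implicit Defensive.
Import Order.TTheory GRing.Theory Num.Theory.
Import numFieldNormedType.Exports.
Local Open Scope classical_set_scope.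
Local Open Scope ring_scope.

(* With g_a(s) = q^-s (zeta(s, a/q) - 1/(s-1)), the Laurent expansion shows that
   near s = 1 the function g_a is the product of q^-s, whose l-th derivative is
   (-log q)^l q^-s, and of a convergent power series with Taylor coefficients
   gamma_r(a/q); Leibniz' rule at s = 1 is the stated formula.  For Re s > 1,
   splitting the Dirichlet series into residue classes gives
   L(s, chi) = sum_a chi(a) q^-s zeta(s, a/q) = sum_a chi(a) g_a(s), the poles
   cancelling because sum_a chi(a) = 0.  Both sides are smooth at s = 1, which
   adheres to the half-plane Re s > 1, so all their derivatives at 1 agree and no
   analytic continuation argument is needed. *)

(** * Sequences of iterated derivatives *)

Section Jets.
Context {K : numFieldType}.
Implicit Types (z : K) (f : K -> K) (F G : nat -> K -> K).

(* [F n] is an [n]-th derivative of [F 0] near [z]; the neighbourhood may shrink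
   as [n] grows. *)
Definition jet z F :=
  forall n, \forall w \near z, is_derive w (1 : K) (F n) (F n.+1 w).

Lemma is_derive_continuous f z d : is_derive z (1 : K) f d -> {for z, continuous f}.
Proof.
by move=> df; apply/differentiable_continuous/derivable1_diffP; exact: ex_derive.
Qed.

Lemma jet_everywhere z F :
  (forall n w, is_derive w (1 : K) (F n) (F n.+1 w)) -> jet z F.
Proof.
move=> dF n; near=> w; exact: dF.
Unshelve. all: by end_near. Qed.

Lemma jet_continuous z F n : jet z F -> {for z, continuous (F n)}.
Proof. by move=> /(_ n) /nbhs_singleton /is_derive_continuous. Qed.

(** Derivatives are local, so agreement on an open set survives differentiation. The set [U] will be
    the punctured plane, a half-plane, or everything. *)
Lemma jet_derive1n (U : set K) z F f n : open U -> jet z F ->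
  (\forall w \near z, U w -> f w = F 0%N w) ->
  \forall w \near z, U w -> derive1n n f w = F n w.
Proof.
move=> oU jF fF0; elim: n => [//|n IHn].
(* [near_join] gives the agreement on a neighbourhood of each [w] close to [z], which is what
   differentiating at [w] requires. *)
move/near_join: IHn (jF n); apply: filterS2 => w fFn dFn Uw.
rewrite derive1nS derive1E.
suff /near_eq_derive -> : \forall v \near w, derive1n n f v = F n v.
  by rewrite derive_val.
by move: fFn (open_nbhs_nbhs (conj oU Uw)); apply: filterS2 => v; exact.
Qed.

Lemma jet_derive1n_center z F f n : jet z F -> {near z, f =1 F 0%N} ->
  derive1n n f z = F n z.
Proof.
move=> jF fF0; have fF0T : \forall w \near z, setT w -> f w = F 0%N w.
  by apply: filterS fF0 => w ->.
exact: (nbhs_singleton (jet_derive1n n openT jF fF0T)).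
Qed.

Lemma jet_sum (I : eqType) (s : seq I) z (c : I -> K) (F : I -> nat -> K -> K) :
  (forall i, i \in s -> jet z (F i)) ->
  jet z (fun n w => \sum_(i <- s) c i * F i n w).
Proof.
move=> + n; elim: s => [_|i s IHs jF].
  near=> w; rewrite big_nil.
  rewrite (_ : (fun _ => _) = cst 0); first exact: is_derive_cst.
  by apply/funext => v; rewrite big_nil.
have {}IHs : \forall w \near z, is_derive w (1 : K)
    (fun v => \sum_(j <- s) c j * F j n v) (\sum_(j <- s) c j * F j n.+1 w).
  by apply: IHs => j js; apply: jF; rewrite in_cons js orbT.
move: IHs (jF i (mem_head i s) n); apply: filterS2 => w dS dF.
rewrite big_cons (_ : (fun _ => _) =
  c i *: F i n + (fun v => \sum_(j <- s) c j * F j n v)).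
  exact: is_deriveD.
by apply/funext => v; rewrite big_cons.
Unshelve. all: by end_near. Qed.

(* This replaces the identity theorem: [z] only has to adhere to [U], since the
   derivatives are continuous at [z]. *)
Lemma jet_eq_center (U : set K) z F G n : open U -> closure U z ->
  jet z F -> jet z G -> (\forall w \near z, U w -> F 0%N w = G 0%N w) ->
  F n z = G n z.
Proof.
move=> oU Uz jF jG FG.
(* Properness encodes that [z] adheres to [U]; it makes limits along [U] unique. *)
have UF : ProperFilter (within U (nbhs z)) by exact: within_nbhs_proper.
have cF : F n w @[w --> within U (nbhs z)] --> F n z.
  by apply: cvg_within_filter; exact: jet_continuous n jF.
have cG : G n w @[w --> within U (nbhs z)] --> G n z.
  by apply: cvg_within_filter; exact: jet_continuous n jG.
apply: (cvg_unique (@norm_hausdorff K K) cF); apply: cvg_trans cG.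
apply: near_eq_cvg; rewrite near_withinE.
have FT : \forall w \near z, setT w -> F 0%N w = F 0%N w.
  by apply: filterE.
move: (jet_derive1n n oU jG FG) (jet_derive1n n openT jF FT).
by apply: filterS2 => w Gw Fw Uw; rewrite -Gw// -Fw.
Qed.

(** This evaluates the limits in [gamma_mod], where the function has a removable singularity at [z]:
    [jet_derive1n] applies on the complement of [z]. *)
Lemma jet_derive1n_dnbhs z F f n : jet z F ->
  (\forall w \near z, w != z -> f w = F 0%N w) ->
  derive1n n f w @[w --> z^'] --> F n z.
Proof.
move=> jF fF0.
have cF : F n w @[w --> z^'] --> F n z.
  by apply: cvg_within_filter; exact: jet_continuous n jF.
apply: cvg_trans cF; apply: near_eq_cvg; rewrite near_withinE.
have oz : open [set w : K | w != z].
  rewrite (_ : [set _ | _] = ~` [set z]); last first.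
    by apply/seteqP; split=> w /= /eqP.
  by rewrite openC; exact/accessible_closed_set1/hausdorff_accessible/norm_hausdorff.
by move: (jet_derive1n n oz jF fF0); apply: filterS => w fw /fw.
Qed.

Definition leibniz F G n w :=
  \sum_(l < n.+1) 'C(n, l)%:R * (F l w * G (n - l)%N w).

(** Pascal's rule splits each binomial coefficient of order [n.+1]; the two halves are the terms
    where [G], respectively [F], is differentiated once more. *)
Lemma leibnizS F G n w :
  leibniz F G n.+1 w =
  \sum_(l < n.+1) 'C(n, l)%:R *
    (F l w * G (n - l).+1 w + G (n - l)%N w * F l.+1 w).
Proof.
under [RHS]eq_bigr => l _ do
  rewrite mulrDr -(subSn (ltn_ord l : l <= n)%N) [G _ w * F _ _]mulrC.
rewrite big_split/= /leibniz big_ord_recl/= bin0 subn0.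
under eq_bigr => l _ do rewrite /bump/= add1n subSS binS natrD mulrDl.
rewrite big_split/= addrA; congr (_ + _).
rewrite [RHS]big_ord_recl/= bin0 subn0; congr (_ + _).
rewrite big_ord_recr/= bin_small// mul0r addr0.
by apply: eq_bigr => l _; rewrite /bump/= add1n subSS.
Qed.

(** The neighbourhoods in a jet depend on the order, so finitely many of them are intersected. *)
Lemma near_all_lt (T : Type) (A : set_system T) (P : nat -> T -> Prop) n :
  Filter A -> (forall l, \forall x \near A, P l x) ->
  \forall x \near A, forall l, (l < n)%N -> P l x.
Proof.
move=> FA AP; elim: n => [|n IHn]; first exact: nearW.
move: (AP n) IHn; apply: filterS2 => x Pn Pl l.
by rewrite ltnS leq_eqVlt => /predU1P[->|/Pl].
Qed.

Lemma jet_mul z F G : jet z F -> jet z G -> jet z (leibniz F G).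
Proof.
move=> jF jG n.
move: (near_all_lt n.+1 (nbhs_filter z) jF) (near_all_lt n.+1 (nbhs_filter z) jG).
apply: filterS2 => w dF dG; rewrite leibnizS.
rewrite (_ : leibniz F G n =
  \sum_(l < n.+1) ('C(n, l)%:R *: (F l * G (n - l)%N))).
  apply: is_derive_sum => l; apply: is_deriveZ.
  apply: is_deriveM; first exact: dF.
  by apply: dG; rewrite ltnS leq_subr.
by apply/funext => v; rewrite /leibniz fct_sumE.
Qed.

End Jets.

(** * Power series over a complete field *)

Section PowerSeriesCoefficients.
Context {K : numFieldType}.
Implicit Types (c : nat -> K) (w h : K).

(** This expresses a positive radius of convergence without a limsup. *)
Definition geometric_bound c :=
  exists M A : K, [/\ 0 <= M, 0 < A & forall k, `|c k| <= M * A ^+ k].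

Definition deriv_coeffs c (k : nat) : K := k.+1%:R * c k.+1.

Lemma bounded_of_cvg0 (u : nat -> K) : u @ \oo --> 0 ->
  exists2 M : K, 0 <= M & forall k, `|u k| <= M.
Proof.
move=> /cvgr0_norm_le /(_ _ ltr01) [N _ uN].
exists (1 + \sum_(k < N) `|u k|); first by rewrite addr_ge0// sumr_ge0.
move=> k; case: (ltnP k N) => [kN|Nk].
  rewrite (bigD1 (Ordinal kN))//= addrCA lerDl.
  by rewrite addr_ge0// sumr_ge0.
by rewrite (le_trans (uN k Nk))// lerDl sumr_ge0.
Qed.

(** Convergence at [w] forces the terms to be bounded, so the ratio [1/|w|] works. *)
Lemma geometric_bound_cvg c w : w != 0 ->
  cvgn (series (fun k => c k * w ^+ k)) -> geometric_bound c.
Proof.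
move=> w0 /cvg_series_cvg_0 /bounded_of_cvg0[M M0 cM].
exists M, `|w|^-1; split=> // [|k]; first by rewrite invr_gt0 normr_gt0.
by rewrite exprVn ler_pdivlMr ?exprn_gt0 ?normr_gt0// -normrX -normrM.
Qed.

Lemma nat_le_exp2 n : n%:R <= 2 ^+ n :> K.
Proof. by rewrite -natrX ler_nat ltnW// ltn_expl. Qed.

(** The factor [k.+1] is absorbed by doubling the ratio, since [k.+1 <= 2 ^+ k.+1]. *)
Lemma geometric_bound_deriv c :
  geometric_bound c -> geometric_bound (deriv_coeffs c).
Proof.
move=> [M [A [M0 A0 cMA]]]; exists (2 * A * M), (2 * A).
split=> [| |k]; [by rewrite !mulr_ge0// ltW|by rewrite mulr_gt0|].
rewrite normrM normr_nat.
have := ler_pM (ler0n _ _) (normr_ge0 _) (nat_le_exp2 k.+1) (cMA k.+1).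
move=> leN; apply: (le_trans leN); rewrite le_eqVlt exprMn !exprS.
by apply/orP; left; apply/eqP; ring.
Qed.

Lemma sum_half_le2 n : \sum_(0 <= k < n) (2^-1 : K) ^+ k <= 2.
Proof.
suff -> : \sum_(0 <= k < n) (2^-1 : K) ^+ k = 2 - 2 * 2^-1 ^+ n.
  by rewrite gerBl mulr_ge0// exprn_ge0// invr_ge0.
elim: n => [|n IHn]; first by rewrite big_nil expr0 mulr1 subrr.
by rewrite big_nat_recr//= IHn exprS; field.
Qed.

(* The crude factor [2 ^+ n] stands for the usual [n ^ 2]: it is harmless because
   power series are only evaluated well inside their disc of convergence. *)
Lemma taylor1_exprn_le (r w h : K) n : 0 < r -> `|w| <= r -> `|w + h| <= r ->
  `|(w + h) ^+ n - w ^+ n - h * (n%:R * w ^+ n.-1)|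
    <= `|h| ^+ 2 / r ^+ 2 * (2 * r) ^+ n.
Proof.
move=> r0 wr whr; elim: n => [|n IHn].
  by rewrite !expr0 subrr mul0r mulr0 subr0 normr0 mulr1 divr_ge0// exprn_ge0// ltW.
(* The remainders satisfy [T (n+1) = (w + h) * T n + n * h^2 * w^(n-1)]. The case [n = 0] is
   separate because [n.-1] truncates. *)
have -> : (w + h) ^+ n.+1 - w ^+ n.+1 - h * (n.+1%:R * w ^+ n.+1.-1) =
    (w + h) * ((w + h) ^+ n - w ^+ n - h * (n%:R * w ^+ n.-1))
    + h ^+ 2 * (n%:R * w ^+ n.-1).
  case: n {IHn} => [|n] /=; first by rewrite !expr0; ring.
  by rewrite !exprS !mulrSr; ring.
apply: le_trans (ler_normD _ _) _.
(* The bound grows by a factor [2 * r]: one [r] pays for the multiplication by [w + h], the other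
   for the new quadratic term. *)
have -> : `|h| ^+ 2 / r ^+ 2 * (2 * r) ^+ n.+1 =
    r * (`|h| ^+ 2 / r ^+ 2 * (2 * r) ^+ n) + 
    `|h| ^+ 2 * ((2 * r) ^+ n / r).
  by rewrite [_ ^+ n.+1]exprS; move: (_ ^+ n) => P; field; rewrite gt_eqF.
apply: lerD; first by rewrite normrM ler_pM.
rewrite normrM normrX ler_wpM2l ?exprn_ge0//.
case: n {IHn} => [|n] /=; first by rewrite mul0r normr0 mul1r invr_ge0 ltW.
rewrite ler_pdivlMr// normrM normr_nat normrX exprMn -mulrA.
have r_ge0 := ltW r0; rewrite ler_pM ?mulr_ge0 ?exprn_ge0 ?nat_le_exp2//.
by rewrite exprSr ler_wpM2r// lerXn2r// qualifE.
Qed.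

End PowerSeriesCoefficients.

(** The remainder form includes [h = 0] and involves no quotient, so such estimates can be summed
    over a series or over real and imaginary parts. *)
Lemma is_derive_of_littleo {K : numFieldType} (f : K -> K) (w l : K) :
  (forall e : K, 0 < e ->
     \forall h \near (0 : K), `|f (w + h) - f w - h * l| <= e * `|h|) ->
  is_derive w (1 : K) f l.
Proof.
move=> fl; have cl : h^-1 *: (f (h *: 1 + w) - f w) @[h --> 0^'] --> l.
  apply/cvgrPdist_le => e e0; rewrite near_withinE.
  apply: filterS (fl e e0) => h fh h0.
  rewrite /= [_%:A]mulr1 [h + w]addrC distrC.
  have -> : h^-1 *: (f (w + h) - f w) - l = h^-1 * (f (w + h) - f w - h * l).
    by rewrite [RHS]mulrBr mulKf.
  by rewrite normrM normfV mulrC ler_pdivrMr ?normr_gt0.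
by apply: DeriveDef; [exact: cvgP cl|exact: cvg_lim cl].
Qed.

Lemma littleo_of_is_derive {K : numFieldType} (f : K -> K) (w l e : K) :
  is_derive w (1 : K) f l -> 0 < e ->
  \forall h \near (0 : K), `|f (w + h) - f w - h * l| <= e * `|h|.
Proof.
move=> [df <-] e0; have cl : h^-1 *: (f (h *: 1 + w) - f w)
    @[h --> 0^'] --> 'D_1 f w.
  exact: df.
move/cvgrPdist_le: cl => /(_ e e0); rewrite near_withinE.
apply: filterS => h fh; have [->|h0] := eqVneq h 0.
  by rewrite addr0 subrr mul0r subr0 normr0 mulr0.
move: (fh h0); rewrite /= [_%:A]mulr1 [h + w]addrC distrC.
have -> : h^-1 *: (f (w + h) - f w) - 'D_1 f w =
    h^-1 * (f (w + h) - f w - h * 'D_1 f w).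
  by rewrite [RHS]mulrBr mulKf.
by rewrite normrM normfV mulrC ler_pdivrMr ?normr_gt0.
Qed.

(** * Convergence and termwise differentiation of power series *)

Section PowerSeries.
Context {K : numFieldType}.
Implicit Types (z w h : K) (c : nat -> K).

(* The only form of completeness that power series need; [CC R] carries no
   [completeType] structure. *)
Definition geometric_complete := forall (u : nat -> K) (M : K),
  (forall k, `|u k| <= M * 2^-1 ^+ k) -> cvgn (series u).

Definition psum c z w := limn (series (fun k => c k * (w - z) ^+ k)).

Lemma cvgn_norm_le (u : nat -> K) (l B : K) : u @ \oo --> l ->
  (forall n, `|u n| <= B) -> `|l| <= B.
Proof.
move=> ul uB; apply/ler_addgt0Pr => e e0.
have /cvgr_dist_le /(_ e e0) [n _ /(_ n (leqnn n)) ln] := ul.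
rewrite -(subrK (u n) l) addrC (le_trans (ler_normD _ _))//.
exact: lerD.
Qed.

(** On the disc of radius [1/(2A)] the k-th term is at most [M / 2^k]. *)
Lemma cvg_psum c z (M A w : K) : geometric_complete -> 0 < A ->
  (forall k, `|c k| <= M * A ^+ k) -> `|w - z| <= (2 * A)^-1 ->
  series (fun k => c k * (w - z) ^+ k) @ \oo --> psum c z w.
Proof.
move=> KC A0 cM wz; apply: (KC _ M) => k.
have -> : M * 2^-1 ^+ k = (M * A ^+ k) * (2 * A)^-1 ^+ k.
  by rewrite -mulrA -exprMn invfM mulrCA mulfV ?gt_eqF// mulr1.
rewrite normrM normrX ler_pM ?exprn_ge0//.
by rewrite lerXn2r// qualifE/= ?invr_ge0 ?mulr_ge0// ltW.
Qed.

Lemma cvg_series_shift c (x l : K) :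
  series (fun k => deriv_coeffs c k * x ^+ k) @ \oo --> l ->
  series (fun k => c k * (k%:R * x ^+ k.-1)) @ \oo --> l.
Proof.
move=> cl; rewrite -cvg_shiftS; apply: cvg_trans cl; apply: near_eq_cvg.
apply: nearW => n; rewrite /series/= big_nat_recl//= mul0r mulr0 add0r.
by apply: eq_bigr => k _; rewrite /deriv_coeffs mulrAC mulrC.
Qed.

(** The first-order remainders of the monomials are summed by [taylor1_exprn_le], giving a total
    remainder of at most a constant times [|h|^2]. *)
Lemma is_derive_psum c z : geometric_complete -> geometric_bound c ->
  \forall w \near z, is_derive w (1 : K) (psum c z) (psum (deriv_coeffs c) z w).
Proof.
move=> KC cb; have [M' [A' [M'0 A'0 dcM]]] := geometric_bound_deriv cb.
(* This radius makes [A * (2 * r) = 1/2], so that the remainder bounds form a geometric series of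
   ratio 1/2. *)
have [M [A [M0 A0 cM]]] := cb; pose r : K := (4 * A)^-1.
have r0 : 0 < r by rewrite invr_gt0 mulr_gt0.
have rA : r <= (2 * A)^-1.
  by rewrite lef_pV2 ?qualifE/= ?mulr_gt0// ler_pM2r// ler_nat.
have r'0 : 0 < (2 * A')^-1 by rewrite invr_gt0 mulr_gt0.
near=> w; have wr' : `|w - z| <= (2 * A')^-1.
  by rewrite distrC; near: w; apply: cvgr_dist_le => //; exact: cvg_id.
have wr : `|w - z| < r.
  by rewrite distrC; near: w; apply: cvgr_dist_lt => //; exact: cvg_id.
apply: is_derive_of_littleo => e e0.
(* The final 2 bounds the geometric sum; below, [B + 1] serves as a denominator because [B] may
   vanish. *)
pose B := M / r ^+ 2 * 2.
have B0 : 0 <= B by rewrite mulr_ge0// divr_ge0// exprn_ge0// ltW.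
have B1 : 0 < B + 1 by rewrite ltr_wpDl.
near=> h; have hr : `|h| <= r - `|w - z|.
  by near: h; apply: cvgr0_norm_le; [exact: cvg_id|rewrite subr_gt0].
have hB : `|h| <= e / (B + 1).
  by near: h; apply: cvgr0_norm_le; [exact: cvg_id|rewrite divr_gt0].
have whr : `|w - z + h| <= r.
  by rewrite (le_trans (ler_normD _ _))// -lerBrDl.
have hBe : B * `|h| ^+ 2 <= e * `|h|.
  rewrite expr2 mulrA ler_wpM2r// (le_trans (ler_wpM2l B0 hB))//.
  by rewrite mulrCA ler_piMr ?(ltW e0)// ler_pdivrMr// mul1r lerDl.
apply: le_trans hBe.
have c0 : series (fun k => c k * (w - z) ^+ k) @ \oo --> psum c z w.
  by apply: (cvg_psum KC A0 cM); rewrite (le_trans _ rA)// ltW.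
have c1 : series (fun k => c k * (w - z + h) ^+ k) @ \oo --> psum c z (w + h).
  rewrite addrAC; apply: (cvg_psum KC A0 cM).
  by rewrite (le_trans _ rA)// addrAC.
have c2 := cvg_series_shift (cvg_psum KC A'0 dcM wr').
(* It suffices to bound the partial sums of the remainder uniformly in their length. *)
apply: (cvgn_norm_le (cvgB (cvgB c1 c0) (cvgMl_tmp (a := h) c2))) => n.
rewrite !fctE /series/= mulr_sumr -!sumrB (le_trans (ler_norm_sum _ _ _))//.
apply: (@le_trans _ _ (\sum_(0 <= k < n) M / r ^+ 2 * `|h| ^+ 2 * 2^-1 ^+ k)).
  apply: ler_sum => k _; rewrite mulrCA -!mulrBr normrM.
  apply: (le_trans (ler_pM _ _ (cM k) (taylor1_exprn_le k r0 (ltW wr) whr))) => //.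
  have -> : 2^-1 ^+ k = A ^+ k * (2 * r) ^+ k.
    rewrite -exprMn; congr (_ ^+ _); rewrite /r.
    by field; rewrite gt_eqF.
  rewrite le_eqVlt; apply/orP; left; apply/eqP.
  by move: (A ^+ k) (_ ^+ k) => a b; ring.
rewrite -mulr_sumr /B [leRHS]mulrAC ler_wpM2l ?sum_half_le2//.
by rewrite !mulr_ge0 ?invr_ge0 ?exprn_ge0// (ltW r0).
Unshelve. all: by end_near. Qed.

Lemma cvg_series_center c z :
  series (fun k => c k * (z - z) ^+ k) @ \oo --> c 0%N.
Proof.
rewrite -cvg_shiftS; apply: cvg_near_cst; apply: nearW => n /=.
rewrite /series/= big_nat_recl//= expr0 mulr1 big1 ?addr0// => k _.
by rewrite subrr expr0n mulr0.
Qed.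

Lemma psum_center c z : psum c z z = c 0%N.
Proof. by apply: cvg_lim => //; exact: cvg_series_center. Qed.

Lemma jet_psum c z : geometric_complete -> geometric_bound c ->
  jet z (fun n => psum (iter n deriv_coeffs c) z).
Proof.
move=> KC cb n; apply: is_derive_psum => //.
by elim: n => //= n; exact: geometric_bound_deriv.
Qed.

Lemma iter_deriv_coeffs c n : iter n deriv_coeffs c 0%N = n`!%:R * c n.
Proof.
elim: n c => [|n IHn] c; first by rewrite mul1r.
by rewrite iterSr IHn /deriv_coeffs factS mulnC natrM mulrA.
Qed.

Lemma jet_of_series c z f : geometric_complete ->
  (\forall w \near z, series (fun k => c k * (w - z) ^+ k) @ \oo --> f w) ->
  exists F : nat -> K -> K, [/\ jet z F, {near z, f =1 F 0%N} &
    forall n, F n z = n`!%:R * c n].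
Proof.
move=> KC cf; exists (fun n => psum (iter n deriv_coeffs c) z); split.
- apply: jet_psum => //.
  have [e /= e0 ce] := cf.
  (* The point [z + e / 2] lies in the ball of radius [e] where the series converges and differs
     from the centre. *)
  apply: (@geometric_bound_cvg _ _ (e / 2)); first by rewrite gt_eqF// divr_gt0.
  apply: (@cvgP _ _ (f (z + e / 2))).
  have := ce (z + e / 2); rewrite addrAC subrr add0r; apply.
  rewrite /= opprD addrA subrr add0r normrN gtr0_norm ?divr_gt0//.
  by rewrite ltr_pdivrMr// ltr_pMr// ltr1n.
- by apply: filterS cf => w cw; apply/esym/cvg_lim.
- by move=> n; rewrite psum_center iter_deriv_coeffs.
Qed.

End PowerSeries.

(** * Complex limits through real and imaginary parts *)

Section ComplexLimits.
Context {R : realType}.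
Implicit Types (z w h : CC R) (c : nat -> CC R).

(** Elements comparable in the order of [R[i]] have equal imaginary parts; hence every positive
    radius is real. *)
Lemma gt0_toC (e : CC R) : 0 < e -> exists2 x : R, 0 < x & e = toC x.
Proof.
case: e => a b; rewrite ltcE/= => /andP[/eqP -> a0].
by exists a.
Qed.

Lemma norm_toC (x : R) : `|toC x| = toC `|x|.
Proof. by rewrite /toC normc_def/= expr0n addr0 sqrtr_sqr. Qed.

Lemma toCB (x y : R) : toC (x - y) = toC x - toC y.
Proof. by rewrite /toC rmorphB. Qed.

Lemma norm_Re_le z : toC `|complex.Re z| <= `|z|.
Proof. exact: normc_ge_Re. Qed.

Lemma norm_Im_le z : toC `|complex.Im z| <= `|z|.
Proof.
rewrite -normrN -ReiNIm; apply: le_trans (norm_Re_le _) _.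
by rewrite normrM [`|'i%C|]normc_def/= expr0n expr1n add0r sqrtr1 mulr1.
Qed.

Lemma cvg_toC (T : Type) (A : set_system T) (u : T -> R) (l : R) : Filter A ->
  u @ A --> l -> (fun x => toC (u x)) @ A --> toC l.
Proof.
move=> FA ul; apply/cvgrPdist_lt => _ /gt0_toC[e e0 ->].
move/cvgrPdist_lt: ul => /(_ e e0); apply: filterS => x.
by rewrite -toCB norm_toC ltcR.
Qed.

Lemma cvg_real_series_dominated (u : nat -> R) (M : R) :
  (forall k, `|u k| <= M * 2^-1 ^+ k) -> cvgn (series u).
Proof.
move=> uM; apply: (@normed_cvg R R).
apply: (@series_le_cvg _ (fun k => `|u k|) (geometric M 2^-1)) => // [k|].
  exact: le_trans (uM k).
by apply: is_cvg_geometric_series; rewrite ger0_norm ?invf_lt1// ltr1n.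
Qed.

(** Real and imaginary parts are dominated by the real geometric series with constant
    [complex.Re M], so both converge. *)
Lemma cvg_series_dominated (u : nat -> CC R) (M : CC R) :
  (forall k, `|u k| <= M * 2^-1 ^+ k) -> cvgn (series u).
Proof.
move=> uM; have uMR k : exists2 x : R,
    `|u k| = toC x & x <= complex.Re M * 2^-1 ^+ k.
  have -> : complex.Re M * 2^-1 ^+ k = complex.Re (M * 2^-1 ^+ k : CC R).
    have -> : 2^-1 ^+ k = toC (2^-1 ^+ k) :> CC R.
      by rewrite /toC rmorphXn/= fmorphV/= rmorph_nat.
    by case: M {uM} => a b; rewrite /= mulr0 subr0.
  have := uM k; rewrite lecE => /andP[_ uMk].
  by exists (complex.Re `|u k|).
have reM k : `|complex.Re (u k)| <= complex.Re M * 2^-1 ^+ k.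
  have [x ux] := uMR k; apply: le_trans; rewrite -lecR -[x%:C%C]ux.
  exact: norm_Re_le.
have imM k : `|complex.Im (u k)| <= complex.Re M * 2^-1 ^+ k.
  have [x ux] := uMR k; apply: le_trans; rewrite -lecR -[x%:C%C]ux.
  exact: norm_Im_le.
have /cvg_ex[/= a ua] := cvg_real_series_dominated reM.
have /cvg_ex[/= b ub] := cvg_real_series_dominated imM.
apply: (@cvgP _ _ (toC a + 'i%C * toC b)).
have -> : series u = (fun n => toC (series (fun k => complex.Re (u k)) n))
    \+ (fun n => 'i%C * toC (series (fun k => complex.Im (u k)) n)).
  apply/funext => n; rewrite /series/= /toC !raddf_sum mulr_sumr -big_split/=.
  by apply: eq_bigr => k _; rewrite -complexE.
by apply: cvgD; [|apply: cvgMl_tmp]; exact: cvg_toC.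
Qed.

End ComplexLimits.

(** * The complex exponential *)

Lemma near0_mulr {K : numFieldType} (a : K) (P : set K) :
  (\forall h \near (0 : K), P h) -> \forall h \near (0 : K), P (h * a).
Proof.
move=> P0; have := @mulrr_continuous K a 0; rewrite /continuous_at mul0r.
by apply.
Qed.

Section ComplexExponential.
Context {R : realType}.
Implicit Types (z w h : CC R) (x y : R).

Lemma complete_CC : @geometric_complete (CC R).
Proof. by move=> u M; exact: cvg_series_dominated. Qed.

Lemma norm_le_ReIm z : `|z| <= toC (`|complex.Re z| + `|complex.Im z|).
Proof.
have {1}-> : z = toC (complex.Re z) + 'i%C * toC (complex.Im z).
  exact: complexE.
apply: le_trans (ler_normD _ _) _; rewrite normrM !norm_toC.
rewrite [`|'i%C|]normc_def/= expr0n expr1n add0r sqrtr1 mul1r.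
by rewrite /toC -rmorphD.
Qed.

Lemma near0_Re (P : R -> Prop) : (\forall x \near (0 : R), P x) ->
  \forall h \near (0 : CC R), P (complex.Re h).
Proof.
move=> [e /= e0 Pe]; have : \forall h \near (0 : CC R), `|h| < toC e.
  by apply: nbhs0_lt; rewrite ltcR.
apply: filterS => h he; apply: Pe; rewrite /= sub0r normrN -ltcR.
exact: le_lt_trans (norm_Re_le h) he.
Qed.

Lemma near0_Im (P : R -> Prop) : (\forall x \near (0 : R), P x) ->
  \forall h \near (0 : CC R), P (complex.Im h).
Proof.
move=> [e /= e0 Pe]; have : \forall h \near (0 : CC R), `|h| < toC e.
  by apply: nbhs0_lt; rewrite ltcR.
apply: filterS => h he; apply: Pe; rewrite /= sub0r normrN -ltcR.
exact: le_lt_trans (norm_Im_le h) he.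
Qed.

Lemma cexpD z w : cexp (z + w) = cexp z * cexp w.
Proof.
case: z w => [a b] [c d]; rewrite /cexp/= expRD cosD sinD.
by apply/eqP; rewrite eq_complex/=; apply/andP; split; apply/eqP; ring.
Qed.

Lemma cexp_toC x : cexp (toC x) = toC (expR x).
Proof. by rewrite /cexp/= cos0 sin0 mulr1 mulr0. Qed.

(** With [h = a + ib], the real part of the remainder is at most [d|a| + 2d|b|] and the imaginary
    part at most [3d|b|], whence the 6. The [Num.min d 1] yields both [expR a <= 2] and
    [|expR a - 1| <= d]. *)
Lemma cexp_sub_le (d : R) h : 0 < d ->
  `|expR (complex.Re h) - 1 - complex.Re h| <= d * `|complex.Re h| ->
  `|expR (complex.Re h) - 1| <= Num.min d 1 ->
  `|cos (complex.Im h) - 1| <= d * `|complex.Im h| ->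
  `|sin (complex.Im h) - complex.Im h| <= d * `|complex.Im h| ->
  `|cexp h - 1 - h| <= toC (6 * d) * `|h|.
Proof.
case: h => a b d0 /= ea; rewrite le_min => /andP[ea1 ea2] cb sb.
have := norm_Im_le (a +i* b)%C; have /= := norm_Re_le (a +i* b)%C.
set H := `|_ : CC R| => aH bH.
have ea3 : expR a <= 2 by move: ea2; rewrite ler_norml => /andP[]; lra.
have ea0 : 0 < expR a := expR_gt0 a.
apply: le_trans (norm_le_ReIm _) _; rewrite /=.
have -> : expR a * cos b - 1 - a = (expR a - 1 - a) + expR a * (cos b - 1) by ring.
have -> : expR a * sin b - 0 - b = expR a * (sin b - b) + (expR a - 1) * b by ring.
have reE : `|(expR a - 1 - a) + expR a * (cos b - 1)| <= d * `|a| + 2 * (d * `|b|).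
  apply: le_trans (ler_normD _ _) _; rewrite lerD// normrM ler_pM//.
  by rewrite ger0_norm// ltW.
have imE : `|expR a * (sin b - b) + (expR a - 1) * b| <= 2 * (d * `|b|) + d * `|b|.
  apply: le_trans (ler_normD _ _) _; rewrite lerD// normrM ler_pM//.
  by rewrite ger0_norm// ltW.
have abH : toC (d * `|a| + 5 * (d * `|b|)) <= toC (6 * d) * H.
  have -> : toC (d * `|a| + 5 * (d * `|b|)) = toC d * toC `|a| + 5 * toC d * toC `|b|.
    by rewrite /toC rmorphD !rmorphM/= rmorph_nat mulrA.
  have -> : toC (6 * d) * H = toC d * H + 5 * toC d * H.
    by rewrite /toC rmorphM/= rmorph_nat; ring.
  have d0C : 0 <= toC d by rewrite ler0c ltW.
  by apply: lerD; rewrite ler_wpM2l// mulr_ge0.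
by apply: le_trans abH; rewrite lecR; lra.
Qed.

Lemma near0_cexp_sub (e : CC R) : 0 < e ->
  \forall h \near (0 : CC R), `|cexp h - 1 - h| <= e * `|h|.
Proof.
move=> /gt0_toC[{}e e0 ->]; pose d := e / 6; have d0 : 0 < d by rewrite divr_gt0.
have exp_o : \forall x \near (0 : R), `|expR x - 1 - x| <= d * `|x|.
  have := littleo_of_is_derive (is_derive_expR 0) d0.
  by apply: filterS => x; rewrite add0r expR0 mulr1.
have exp_1 : \forall x \near (0 : R), `|expR x - 1| <= Num.min d 1.
  have := @continuous_expR R 0; rewrite /continuous_at expR0.
  move=> /cvgr_dist_le; have m0 : 0 < Num.min d 1 by rewrite lt_min d0 ltr01.
  by move=> /(_ _ m0); apply: filterS => x; rewrite distrC.
have cos_o : \forall x \near (0 : R), `|cos x - 1| <= d * `|x|.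
  have := littleo_of_is_derive (is_derive_cos 0) d0.
  by apply: filterS => x; rewrite add0r cos0 sin0 oppr0 mulr0 subr0.
have sin_o : \forall x \near (0 : R), `|sin x - x| <= d * `|x|.
  have := littleo_of_is_derive (is_derive_sin 0) d0.
  by apply: filterS => x; rewrite add0r cos0 sin0 subr0 mulr1.
have -> : e = 6 * d by rewrite /d mulrC divfK.
near=> h; apply: cexp_sub_le => //; near: h.
- exact: near0_Re exp_o.
- exact: near0_Re exp_1.
- exact: near0_Im cos_o.
- exact: near0_Im sin_o.
Unshelve. all: by end_near. Qed.

Lemma cpowD x z w : cpow x (z + w) = cpow x z * cpow x w.
Proof. by rewrite /cpow mulrDl cexpD. Qed.

Lemma cpowM x y z : 0 < x -> 0 < y -> cpow (x * y) z = cpow x z * cpow y z.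
Proof. by move=> x0 y0; rewrite /cpow lnM ?posrE// /toC rmorphD/= mulrDr cexpD. Qed.

Lemma cpowN1 x : 0 < x -> cpow x (-1) = toC x^-1.
Proof.
move=> x0; rewrite /cpow mulN1r /toC -rmorphN -/(toC _) cexp_toC expRN.
by rewrite lnK ?posrE.
Qed.

Lemma is_derive_cpowN x z :
  is_derive z (1 : CC R) (fun s : CC R => cpow x (- s)) (- toC (ln x) * cpow x (- z)).
Proof.
apply: is_derive_of_littleo => e e0; set L := toC (ln x); set E := cpow x (- z).
(* The addition law reduces the claim to the expansion of [cexp] at 0, scaled by [E] and [L]. Adding
   1 keeps the denominator positive even if [L = 0], as for [x = 1]. *)
pose e' := e / ((`|E| + 1) * (`|L| + 1)).
have E1 : 0 < `|E| + 1 by rewrite ltr_wpDl.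
have L1 : 0 < `|L| + 1 by rewrite ltr_wpDl.
have e'0 : 0 < e' by rewrite divr_gt0// mulr_gt0.
apply: filterS (near0_mulr (- L) (near0_cexp_sub e'0)) => h hL.
have -> : cpow x (- (z + h)) - E - h * (- L * E) =
    E * (cexp (h * - L) - 1 - h * - L).
  by rewrite opprD cpowD -/E /cpow -/L mulNr -mulrN; ring.
rewrite normrM; apply: le_trans (ler_wpM2l (normr_ge0 E) hL) _.
rewrite normrM normrN /e'.
have -> : `|E| * (e / ((`|E| + 1) * (`|L| + 1)) * (`|h| * `|L|)) =
  e * `|h| * ((`|E| / (`|E| + 1)) * (`|L| / (`|L| + 1))).
  by field; rewrite !gt_eqF.
have f0 (t : CC R) : 0 <= `|t| / (`|t| + 1) by rewrite divr_ge0// addr_ge0.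
have f1 (t : CC R) : 0 < `|t| + 1 -> `|t| / (`|t| + 1) <= 1.
  by move=> t1; rewrite ler_pdivrMr// mul1r lerDl.
have eh : 0 <= e * `|h| by rewrite mulr_ge0// ltW.
by rewrite ler_piMr// mulr_ile1// ?f0// f1.
Qed.

Lemma jet_cpowN x z :
  jet z (fun n s => (- toC (ln x)) ^+ n * cpow x (- s)).
Proof.
apply: jet_everywhere => n w; rewrite exprSr -mulrA.
exact: is_deriveZ (is_derive_cpowN x w).
Qed.

End ComplexExponential.

(** * Hurwitz zeta functions and Dirichlet L-functions *)

Section HurwitzJet.
Context {R : realType}.
Implicit Types (zeta : R -> CC R -> CC R) (s : CC R) (chi : nat -> CC R).

Lemma laurent_jet (Z : CC R -> CC R) (g : nat -> CC R) :
  is_laurent_at1 Z g ->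
  exists P : nat -> CC R -> CC R, [/\ jet (1 : CC R) P,
    \forall s \near (1 : CC R), s != 1 -> Z s - (s - 1)^-1 = P 0%N s &
    forall n, P n 1 = n`!%:R * g n].
Proof.
rewrite /is_laurent_at1 near_withinE => Zg.
(* The value at 1 is replaced by the constant term, so that the series converges to [f] on a full
   neighbourhood. *)
pose f s := if s == 1 then g 0%N else Z s - (s - 1)^-1.
have [] := @jet_of_series (CC R) g 1 f complete_CC.
  apply: filterS Zg => s; rewrite /f; have [-> _|s1 /(_ isT)//] := eqVneq s 1.
  exact: cvg_series_center.
move=> P [jP fP Pn]; exists P; split=> //; apply: filterS fP => s <- s1.
by rewrite /f (negPf s1).
Qed.

Lemma hurwitz_reg_jet zeta (g : nat -> CC R) (a q : nat) : (0 < q)%N ->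
  is_laurent_at1 (zeta (a%:R / q%:R)) g ->
  exists J : nat -> CC R -> CC R, [/\ jet (1 : CC R) J,
    \forall s \near (1 : CC R), s != 1 -> hurwitz_reg zeta a q s = J 0%N s &
    forall r, J r 1 = r`!%:R / q%:R *
      \sum_(0 <= l < r.+1)
        (-1) ^+ l / l`!%:R * toC (ln (q%:R : R)) ^+ l * g (r - l)%N].
Proof.
move=> q0 /laurent_jet[P [jP ZP Pn]]; pose L := toC (ln (q%:R : R)).
pose E n s := (- L) ^+ n * cpow (q%:R : R) (- s).
have jE : jet (1 : CC R) E by exact: jet_cpowN.
exists (leibniz E P); split; first exact: jet_mul.
  apply: filterS ZP => s ZP s1; rewrite /leibniz big_ord1 bin0 mul1r subnn.
  by rewrite -ZP// /E expr0 mul1r.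
move=> r; rewrite /leibniz big_mkord mulr_sumr; apply: eq_bigr => l _.
rewrite Pn /E cpowN1 ?ltr0n//.
have -> : toC (q%:R^-1 : R) = q%:R^-1 by rewrite /toC fmorphV/= rmorph_nat.
have lr : (l <= r)%N by rewrite -ltnS.
have l0 : l`!%:R != 0 :> CC R by rewrite pnatr_eq0 -lt0n fact_gt0.
(* Writing [r!] as the binomial coefficient times [l! (r - l)!] matches the Leibniz term, whose
   factor [1/q] is the value of [q^-s] at 1. *)
rewrite [(- L) ^+ l]exprNn -/L -(bin_fact lr) !natrM.
move: ((-1) ^+ l) (L ^+ l) (g _) l0 => a1 a2 a3.
move: (l`!%:R : CC R) ((r - l)`!%:R : CC R) ('C(r, l)%:R : CC R) => b1 b2 b3 b0.
have q0' : q%:R != 0 :> CC R by rewrite pnatr_eq0 -lt0n.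
move: (q%:R : CC R) q0' => q' q0'.
by field; rewrite b0.
Qed.

End HurwitzJet.

(** * Vanishing of the sum of a non-principal character *)

Section DirichletCharacters.
Context {R : realType}.
Implicit Types (chi : nat -> CC R).

Lemma character_modn (q : nat) chi n : is_dirichlet_character q chi ->
  chi (n %% q)%N = chi n.
Proof.
move=> [_ _ chiD _]; rewrite [in RHS](divn_eq n q) addnC.
elim: (n %/ q)%N => [|k IHk]; first by rewrite mul0n addn0.
by rewrite mulSn addnCA addnC chiD.
Qed.

(** Multiplication by some [n] coprime to [q] with [chi n != 1] permutes the residues, so the sum
    [S] satisfies [chi n * S = S]. *)
Lemma sum_nonprincipal_character (q : nat) chi : (0 < q)%N ->
  is_dirichlet_character q chi -> ~ is_principal q chi ->
  \sum_(1 <= a < q.+1) chi a = 0.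
Proof.
case: q => // q _ chiq /existsNP[n /not_implyP[nq /eqP chin]].
have [_ chiM chiD _] := chiq.
(* The modulus is now [q.+1]; by periodicity its term is moved to residue 0, which lets ['I_q.+1]
   index the sum. *)
have -> : \sum_(1 <= a < q.+2) chi a = \sum_(a < q.+1) chi a.
  rewrite big_nat_recr//= -[q.+1]add0n chiD -[RHS](big_mkord xpredT).
  by rewrite [RHS]big_nat_recl// addrC big_add1.
set S := \sum_(a < _) _; have : chi n * S = S.
  pose m (a : 'I_q.+1) : 'I_q.+1 := inord (n * a %% q.+1).
  have mE a : m a = (n * a %% q.+1)%N :> nat by rewrite inordK// ltn_pmod.
  have m_inj : injective m.
    move=> a b /(congr1 val); rewrite /= !mE => /eqP; apply: contraTeq.
    wlog ab : a b / (a < b)%N.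
      move=> H /[dup] ab; rewrite -val_eqE/= neq_ltn => /orP[ab'|ba'].
        exact: H ab.
      by rewrite eq_sym; apply: H => //; rewrite eq_sym.
    move=> _; rewrite eq_sym eqn_mod_dvd ?leq_mul2l ?(ltnW ab) ?orbT//.
    rewrite -mulnBr Gauss_dvdr; last by rewrite coprime_sym.
    by rewrite gtnNdvd ?subn_gt0// (leq_ltn_trans (leq_subr _ _)).
  rewrite {2}/S (reindex_inj m_inj)/= mulr_sumr; apply: eq_bigr => a _.
  by rewrite mE (character_modn _ chiq) chiM.
move/eqP; rewrite -subr_eq0 -[X in _ - X]mul1r -mulrBl mulf_eq0 subr_eq0.
by rewrite (negPf chin) => /eqP.
Qed.

End DirichletCharacters.

(** * Splitting L-series into residue classes *)

Section DirichletHurwitz.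
Context {R : realType}.
Implicit Types (zeta : R -> CC R -> CC R) (s : CC R) (chi : nat -> CC R).

Lemma cvgn_linear_comb (K : numFieldType) (I : Type) (r : seq I) (u : I -> nat -> K)
    (c l : I -> K) :
  (forall i, u i @ \oo --> l i) ->
  (fun n => \sum_(i <- r) c i * u i n) @ \oo --> \sum_(i <- r) c i * l i.
Proof.
move=> ul; elim: r => [|i r IHr].
  by rewrite big_nil; under eq_fun do rewrite big_nil; exact: cvg_cst.
rewrite big_cons; under eq_fun do rewrite big_cons.
by apply: cvgD => //; apply: cvgMl_tmp.
Qed.

Lemma cvg_mulnr (K : numFieldType) (u : nat -> K) (l : K) (q : nat) :
  (0 < q)%N -> u @ \oo --> l -> (fun n => u (n * q)%N) @ \oo --> l.
Proof.
move=> q0 ul; apply: (cvg_comp _ _ _ ul) => A [N _ NA].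
by exists N => // n /= Nn; apply: NA => /=; rewrite (leq_trans Nn)// leq_pmulr.
Qed.

(** Partial sums of length [N * q] contain exactly [N] terms of each residue class, so only finite
    sums are rearranged before passing to the limit. *)
Lemma dirichlet_L_hurwitz (q : nat) chi (Lf : CC R -> CC R) zeta s :
  (0 < q)%N -> is_dirichlet_character q chi -> is_dirichlet_L chi Lf ->
  (forall a, (1 <= a <= q)%N -> is_hurwitz_zeta (a%:R / q%:R) (zeta (a%:R / q%:R))) ->
  1 < complex.Re s ->
  Lf s = \sum_(1 <= a < q.+1) chi a * (cpow q%:R (- s) * zeta (a%:R / q%:R) s).
Proof.
move=> q0 chiq [Ls _] hz s1; have [_ _ chiD _] := chiq.
have qR : 0 < q%:R :> R by rewrite ltr0n.
have chiMq m n : chi (n + m * q)%N = chi n.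
  elim: m => [|m IHm]; first by rewrite mul0n addn0.
  by rewrite mulSn addnCA addnC chiD.
have cz (b : 'I_q) := (hz b.+1 (ltn_ord b)).1 s s1.
have := cvgn_linear_comb (r := index_enum 'I_q)
  (c := fun b : 'I_q => chi b.+1 * cpow q%:R (- s)) cz.
set u := (fun n : nat => _) => ul.
have Lu := cvg_mulnr q0 (Ls s s1).
have -> : \sum_(1 <= a < q.+1) chi a * (cpow q%:R (- s) * zeta (a%:R / q%:R) s) =
  \sum_(b < q) chi b.+1 * cpow q%:R (- s) * zeta (b.+1%:R / q%:R) s.
  rewrite big_add1/= big_mkord; apply: eq_bigr => b _; exact: mulrA.
apply: (cvg_unique (@norm_hausdorff (CC R) (CC R)) Lu); apply: cvg_trans ul.
apply: near_eq_cvg; near=> N; rewrite /u /series/= big_nat_mul.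
under eq_bigr => b _ do rewrite mulr_sumr.
rewrite exchange_big/=; apply: eq_bigr => m _.
rewrite mulSn -[X in index_iota X _]add0n big_addn addnK big_mkord.
apply: eq_bigr => b _.
(* Here [b] runs from 0, so the residue is [a = b.+1], between 1 and [q]. *)
have -> : ((b + m * q).+1%:R : R) = q%:R * (m%:R + b.+1%:R / q%:R).
  rewrite -addSn natrD natrM; field; exact: lt0r_neq0.
rewrite cpowM//; last first.
  by rewrite ltr_wpDl// divr_gt0.
by rewrite -addSn chiMq mulrA.
Unshelve. all: by end_near. Qed.

Lemma open_Re_gt1 : open [set s : CC R | 1 < complex.Re s].
Proof.
rewrite openE => s /= s1.
have e0 : 0 < toC (complex.Re s - 1) by rewrite ltcR subr_gt0.
have : \forall t \near s, `|s - t| < toC (complex.Re s - 1).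
  exact: nbhsx_ballx e0.
apply: filterS => t st; have := le_lt_trans (norm_Re_le _) st.
rewrite ltcR; case: (s) (t) => a b [c d] /=.
by rewrite ltr_norml => /andP[]; lra.
Qed.

Lemma closure_Re_gt1 : closure [set s : CC R | 1 < complex.Re s] 1.
Proof.
move=> B [_ /gt0_toC[e e0 ->] eB]; exists (toC (1 + e / 2)); split=> /=.
  by rewrite ltrDl divr_gt0.
apply: eB => /=; have -> : 1 - toC (1 + e / 2) = - toC (e / 2).
  by rewrite /toC rmorphD/= opprD addrA subrr add0r.
rewrite normrN norm_toC ltcR ger0_norm ?divr_ge0 ?(ltW e0)//.
by rewrite ltr_pdivrMr// ltr_pMr// ltr1n.
Qed.

End DirichletHurwitz.

Theorem mainTheorem4 (R : realType)
    (zeta : R -> CC R -> CC R) (gamma : nat -> R -> CC R)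
    (hzeta : forall alpha : R, 0 < alpha -> alpha <= 1 ->
       is_hurwitz_zeta alpha (zeta alpha))
    (hgamma : forall alpha : R, 0 < alpha -> alpha <= 1 ->
       is_laurent_at1 (zeta alpha) (fun r => gamma r alpha))
    (q : nat) (hq : (1 <= q)%N) :
  (* the limits defining gamma_mod exist *)
  (forall r a : nat, (1 <= a <= q)%N ->
     cvg (derive1n r (hurwitz_reg zeta a q) s @[s --> (1 : CC R)^'])) /\
  (forall (chi : nat -> CC R) (L : CC R -> CC R),
     is_dirichlet_character q chi -> ~ is_principal q chi ->
     is_dirichlet_L chi L ->
     forall r : nat,
       derive1n r L 1 =
       \sum_(1 <= a < q.+1) chi a * ((-1) ^+ r * gamma_mod zeta r a q)) /\
  (forall r a : nat, (1 <= a <= q)%N ->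
     (-1) ^+ r * gamma_mod zeta r a q =
     r`!%:R / q%:R *
     \sum_(0 <= l < r.+1)
        (-1) ^+ l / l`!%:R * toC (ln (q%:R : R)) ^+ l *
        gamma (r - l)%N (a%:R / q%:R)).
Proof.
have aq_unit a : (1 <= a <= q)%N -> 0 < a%:R / q%:R :> R /\ a%:R / q%:R <= 1 :> R.
  move=> /andP[a0 aq]; rewrite divr_gt0 ?ltr0n//; split=> //.
  by rewrite ler_pdivrMr ?ltr0n// mul1r ler_nat.
(* [choice] needs a jet for every [a]; outside the range the zero sequence serves as a default. *)
have /choice[J HJ] : forall a, exists J, (1 <= a <= q)%N ->
    [/\ jet (1 : CC R) J,
    \forall s \near (1 : CC R), s != 1 -> hurwitz_reg zeta a q s = J 0%N s &
    forall r, J r 1 = r`!%:R / q%:R *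
      \sum_(0 <= l < r.+1) (-1) ^+ l / l`!%:R * toC (ln (q%:R : R)) ^+ l *
        gamma (r - l)%N (a%:R / q%:R)].
  move=> a; case: (boolP (1 <= a <= q)%N) => [aq|]; last by exists (fun _ _ => 0).
  have [a0 a1] := aq_unit a aq.
  by have [J HJ] := hurwitz_reg_jet hq (hgamma _ a0 a1); exists J.
have regJ r a : (1 <= a <= q)%N ->
    derive1n r (hurwitz_reg zeta a q) s @[s --> (1 : CC R)^'] --> J a r 1.
  by move=> /HJ[jJ zJ _]; exact: jet_derive1n_dnbhs.
have gammaJ r a : (1 <= a <= q)%N -> (-1) ^+ r * gamma_mod zeta r a q = J a r 1.
  move=> aq; rewrite /gamma_mod mulrA -expr2 sqrr_sign mul1r.
  exact: (cvg_lim (@norm_hausdorff (CC R) (CC R)) (regJ r a aq)).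
split; first by move=> r a aq; exact: cvgP (regJ r a aq).
split; last by move=> r a aq; rewrite gammaJ//; have [] := HJ a aq.
move=> chi L chiq chiNp LP r.
pose S n s := \sum_(a <- index_iota 1 q.+1) chi a * J a n s.
have [c cL] := LP.2 1.
have [A [jA LA _]] := jet_of_series complete_CC cL.
have jS : jet (1 : CC R) S.
  by apply: jet_sum => a; rewrite mem_index_iota ltnS => /HJ[].
(* One neighbourhood of 1 is made to work for all residues at once. *)
have zJ : \forall s \near (1 : CC R), forall a, (a < q.+1)%N ->
    (1 <= a <= q)%N -> s != 1 -> hurwitz_reg zeta a q s = J a 0%N s.
  apply: (near_all_lt q.+1 (nbhs_filter (1 : CC R))) => a.
  case: (boolP (1 <= a <= q)%N) => [aq|_].
    by have [_ zJ _] := HJ a aq; apply: filterS zJ => s ? _.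
  exact: filterE.
transitivity (S r 1); last first.
  by apply: eq_big_nat => a; rewrite ltnS => aq; rewrite gammaJ.
rewrite (jet_derive1n_center r jA LA).
apply: (jet_eq_center r open_Re_gt1 closure_Re_gt1 jA jS).
move: LA zJ; apply: filterS2 => s LAs zJs s1.
have s_neq1 : s != 1 by apply: contraTneq s1 => ->; rewrite ltxx.
rewrite -LAs (dirichlet_L_hurwitz hq chiq LP (zeta := zeta) _ s1); last first.
  by move=> a /aq_unit[a0 a1]; exact: hzeta.
have -> : S 0%N s = \sum_(1 <= a < q.+1) chi a * hurwitz_reg zeta a q s.
  by apply: eq_big_nat => a aq; rewrite zJs//; case/andP: aq.
(* The polar term [q^-s / (s - 1)] is the same for every [a], so it factors out against the
   vanishing character sum. *)
under [RHS]eq_bigr => a _ do rewrite /hurwitz_reg mulrBr mulrBr.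
rewrite sumrB -[X in _ = _ - X]mulr_suml (sum_nonprincipal_character hq chiq chiNp).
by rewrite mul0r subr0.
Qed.
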